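(* On the category of sets, normalized distributions form a magmad $(\mathbf{M}\mathbf{D},\mu^{\mathbf{MD}}_\circ,\eta^{\mathbf{MD}}_\circ)$. Moreover, there exists a right action of the subdistribution monad $(\mathbf{D}\mathbf{M},\mu^{\mathbf{DM}}_\bullet,\eta^{\mathbf{DM}}_\bullet)$ on this magmad, i.e. a natural transformation $u_X\colon\mathbf{M}\mathbf{D}\mathbf{D}\mathbf{M}X\to\mathbf{M}\mathbf{D}X$ such that $u_X\circ\mathbf{MD}(\eta^{\mathbf{DM}}_{\bullet,X})=\mathrm{id}$ and $u_X\circ\mathbf{MD}(\mu^{\mathbf{DM}}_{\bullet,X})=u_X\circ u_{\mathbf{DM}X}$.
   Context: Distribution monad: $\mathbf{D}X$ is the set of finite formal sums $\sum_i\lambda_i|x_i\rangle$ with $x_i\in X$, $\lambda_i>0$, $\sum_i\lambda_i=1$; unit $x\mapsto|x\rangle$; multiplication $\mu^{\mathbf D}(\sum_i\lambda_i|\sum_j\mu_{ij}|x_{ij}\rangle\rangle)=\sum_{i,j}\lambda_i\mu_{ij}|x_{ij}\rangle$. Maybe monad: $\mathbf{M}X=X+\{\bot\}$, with the usual structure. $\mathbf{D}\mathbf{M}X$ is identified with the set of subdistributions: formal sums $\sum_i\lambda_i|x_i\rangle$ with $\lambda_i>0$, $\sum_i\lambda_i\le1$ (missing mass at $\bot$). $\mathbf{M}\mathbf{D}X$ is identified with the set of normalized distributions: formal sums whose coefficients add up to exactly $1$ or $0$ ($0$ being $\bot$). Subdistribution monad: $\mu^{\mathbf{DM}}_\bullet(\sum_i\lambda_i|\sum_j\mu_{ij}|x_{ij}\rangle\rangle)=\sum_{i,j}\lambda_i\mu_{ij}|x_{ij}\rangle$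 and $\eta^{\mathbf{DM}}_\bullet(x)=|x\rangle$. Normalization $(-)^\circ\colon\mathbf{D}\mathbf{M}X\to\mathbf{M}\mathbf{D}X$: $(\sum_i\lambda_i|x_i\rangle)^\circ=\sum_i\frac{\lambda_i}{\sum_k\lambda_k}|x_i\rangle$ if $\sum_k\lambda_k\ne0$, and $(0)^\circ=0$. The magmad structure: $\eta^{\mathbf{MD}}_\circ(x)=|x\rangle$, and $\mu^{\mathbf{MD}}_\circ\colon\mathbf{MDMD}X\to\mathbf{MD}X$ is $\mathbf{M}((-)^\circ_{\mathbf{D}X})\colon\mathbf{M}\mathbf{D}\mathbf{M}\mathbf{D}X\to\mathbf{M}\mathbf{M}\mathbf{D}\mathbf{D}X$ followed by the multiplications $\mu^{\mathbf M}$ and $\mu^{\mathbf D}$. Magmad: an endofunctor $N$ with natural transformations $\eta_X\colon X\to NX$ and $\mu_X\colon NNX\to NX$ such that $\mu_X\circ\eta_{NX}=\mathrm{id}_{NX}=\mu_X\circ N(\eta_X)$ (a monad without the associativity axiom). *)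

(* Defs.v *)
From mathcomp Require Import all_boot all_order all_algebra finmap.
From mathcomp Require Import boolp classical_sets functions cardinality.
From mathcomp Require Import fsbigop reals.

Set Implicit Arguments.
Unset Strict Implicit.
Unset Printing Implicit Defensive.

Import Order.TTheory GRing.Theory Num.Theory.
Local Open Scope classical_set_scope.
Local Open Scope ring_scope.

Record functor := Functor {
  functor_obj :> Type -> Type;
  fmap : forall X Y : Type, (X -> Y) -> functor_obj X -> functor_obj Y;
  fmap_id : forall (X : Type) (a : functor_obj X), fmap (@id X) a = a;
  fmap_comp : forall (X Y Z : Type) (g : Y -> Z) (f : X -> Y)
    (a : functor_obj X), fmap (g \o f) a = fmap g (fmap f a) }.
Arguments fmap F {X Y} : rename.

Definition functor_idt : functor :=
  @Functor (fun X => X) (fun _ _ f => f)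
    (fun _ _ => erefl) (fun _ _ _ _ _ _ => erefl).

Lemma functor_comp_id (G F : functor) (X : Type) (a : G (F X)) :
  fmap G (fmap F (@id X)) a = a.
Proof.
rewrite -[RHS](@fmap_id G); congr (fmap G _ a).
by apply: funext => b; exact: fmap_id.
Qed.

Lemma functor_comp_comp (G F : functor) (X Y Z : Type) (g : Y -> Z)
    (f : X -> Y) (a : G (F X)) :
  fmap G (fmap F (g \o f)) a = fmap G (fmap F g) (fmap G (fmap F f) a).
Proof.
rewrite -(@fmap_comp G); congr (fmap G _ a).
by apply: funext => b; exact: fmap_comp.
Qed.

Definition functor_comp (G F : functor) : functor :=
  @Functor (fun X => G (F X)) (fun X Y f => fmap G (fmap F f))
    (@functor_comp_id G F) (@functor_comp_comp G F).

Definition natural (F G : functor) (t : forall X : Type, F X -> G X) : Prop :=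
  forall (X Y : Type) (f : X -> Y) (a : F X),
    t Y (fmap F f a) = fmap G f (t X a).

Record magmad_data := MagmadData {
  magmad_functor :> functor;
  unit_of : forall X : Type, X -> magmad_functor X;
  mult_of : forall X : Type,
    magmad_functor (magmad_functor X) -> magmad_functor X }.
Arguments unit_of N {X} : rename.
Arguments mult_of N {X} : rename.

Definition is_magmad (N : magmad_data) : Prop :=
  [/\ natural (F := functor_idt) (G := N) (fun X => @unit_of N X),
      natural (F := functor_comp N N) (G := N) (fun X => @mult_of N X),
      (forall (X : Type) (a : N X), mult_of N (unit_of N a) = a) &
      (forall (X : Type) (a : N X), mult_of N (fmap N (unit_of N) a) = a)].

Definition mult_associative (N : magmad_data) : Prop :=
  forall (X : Type) (a : N (N (N X))),
    mult_of N (fmap N (mult_of N) a) = mult_of N (mult_of N a).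

Record monad := Monad {
  monad_data :> magmad_data;
  monad_is_magmad : is_magmad monad_data;
  monad_assoc : mult_associative monad_data }.

Definition is_right_action (T : monad) (N : magmad_data)
    (u : forall X : Type, N (T X) -> N X) : Prop :=
  [/\ natural (F := functor_comp N T) (G := N) u,
      (forall (X : Type) (a : N X), u X (fmap N (unit_of T) a) = a) &
      (forall (X : Type) (a : N (T (T X))),
          u X (fmap N (mult_of T) a) = u X (u (T X) a))].

(* [{classic X}] is [X] with the choice structure given by the classical
   axioms, which [\sum_(_ \in _) _] requires of its index type. *)
Definition fsum (R : realType) (X : Type) (F : X -> R) : R :=
  \sum_(x \in [set: {classic X}]) F x.

Lemma fsumE (R : realType) (X : Type) (A : {fset {classic X}}) (F : X -> R) :
  (forall x : {classic X}, x \notin A -> F x = 0) ->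
  fsum F = \sum_(x <- A) F x.
Proof. exact: fsbigTE. Qed.

Lemma eq_fsum (R : realType) (X : Type) (F G : X -> R) :
  F =1 G -> fsum F = fsum G.
Proof. by move=> /funext ->. Qed.

Lemma fsum_ge0 (R : realType) (X : Type) (F : X -> R) :
  (forall x, 0 <= F x) -> 0 <= fsum F.
Proof. by move=> F0; apply: fsumr_ge0 => x _; exact: F0. Qed.

Lemma fsum_delta (R : realType) (X : Type) (a : X) (F : X -> R) :
  fsum (fun x => (`[< a = x >])%:R * F x) = F a.
Proof.
rewrite (@fsumE R X [fset (a : {classic X})]%fset); last first.
  move=> x; rewrite inE => /eqP xa; rewrite asboolF ?mul0r// => ax.
  exact/xa/esym.
by rewrite big_seq_fset1 asboolT// mul1r.
Qed.

Lemma fsum_delta_r (R : realType) (X : Type) (a : X) (F : X -> R) :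
  fsum (fun x => F x * (`[< x = a >])%:R) = F a.
Proof.
rewrite -[RHS]fsum_delta; apply: eq_fsum => x; rewrite mulrC.
by congr (_%:R * _); congr (nat_of_bool _); apply: asbool_equiv_eq; split=> ->.
Qed.

Lemma finite_support2 (R : realType) (X Y : Type) (p : X -> R)
    (k : X -> Y -> R) :
  finite_set [set x | p x != 0] ->
  (forall x, finite_set [set y | k x y != 0]) ->
  finite_set (\bigcup_(x in [set x | p x != 0]) [set y | k x y != 0]).
Proof. by move=> fp fk; apply: bigcup_finite. Qed.

Lemma fsum_bind (R : realType) (X Y : Type) (p : X -> R) (k : X -> Y -> R)
    (g : Y -> R) :
  finite_set [set x | p x != 0] ->
  (forall x, finite_set [set y | k x y != 0]) ->
  fsum (fun y => fsum (fun x => p x * k x y) * g y) =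
  fsum (fun x => p x * fsum (fun y => k x y * g y)).
Proof.
move=> fp fk; have fU := finite_support2 fp fk.
pose A := fset_set ([set x | p x != 0] : set {classic X}).
pose B := fset_set ((\bigcup_(x in [set x | p x != 0])
  [set y | k x y != 0]) : set {classic Y}).
have pA x : x \notin A -> p x = 0.
  rewrite in_fset_set// => /negP; rewrite inE /= => h.
  by apply/eqP/negPn/negP.
have kB x y : p x != 0 -> y \notin B -> k x y = 0.
  move=> px; rewrite in_fset_set// => /negP; rewrite inE /= => h.
  by apply/eqP/negPn/negP => kxy; apply: h; exists x.
have eA y : fsum (fun x => p x * k x y) = \sum_(x <- A) p x * k x y.
  by apply: fsumE => x /pA ->; rewrite mul0r.
rewrite (@fsumE R Y B); last first.
  move=> y yB; rewrite eA big1 ?mul0r// => x _.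
  by have [->|px] := eqVneq (p x) 0; rewrite ?mul0r// kB// mulr0.
rewrite (@fsumE R X A); last by move=> x /pA ->; rewrite mul0r.
under eq_bigr do rewrite eA mulr_suml.
rewrite exchange_big /=; apply: eq_bigr => x _.
have [px0|px] := eqVneq (p x) 0.
  by rewrite px0 mul0r big1// => y _; rewrite !mul0r.
rewrite (@fsumE R Y B); last by move=> y yB; rewrite kB ?mul0r.
by rewrite mulr_sumr; apply: eq_bigr => y _; rewrite mulrA.
Qed.

(* A formal sum is its family of coefficients, so that the terms with
   coefficient [0] are exactly those that do not occur in it. *)
Record dist (R : realType) (X : Type) := Dist {
  coef :> X -> R;
  coef_finite : finite_set [set x | coef x != 0];
  coef_ge0 : forall x, 0 <= coef x;
  coef_sum1 : fsum coef = 1 }.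

Lemma dist_ext (R : realType) (X : Type) (p q : dist R X) : p =1 q -> p = q.
Proof.
case: p q => [p p1 p2 p3] [q q1 q2 q3] /= /funext pq.
by subst q; congr Dist; exact: Prop_irrelevance.
Qed.

Lemma dirac_finite (R : realType) (X : Type) (a : X) :
  finite_set [set x | (`[< a = x >])%:R != 0 :> R].
Proof.
apply: (@sub_finite_set _ _ [set a]); last exact: finite_set1.
by move=> x /=; case: asboolP => [->|]; rewrite ?eqxx.
Qed.

Lemma dirac_ge0 (R : realType) (X : Type) (a x : X) :
  0 <= (`[< a = x >])%:R :> R.
Proof. exact: ler0n. Qed.

Lemma dirac_sum1 (R : realType) (X : Type) (a : X) :
  fsum (fun x => (`[< a = x >])%:R) = 1 :> R.
Proof.
by rewrite -[RHS](@fsum_delta R X a (fun=> 1)); apply: eq_fsum => x; rewrite mulr1.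
Qed.

Definition dunit (R : realType) (X : Type) (a : X) : dist R X :=
  Dist (@dirac_finite R X a) (@dirac_ge0 R X a) (@dirac_sum1 R X a).

Lemma bind_finite (R : realType) (X Y : Type) (p : dist R X)
    (k : X -> dist R Y) :
  finite_set [set y | fsum (fun x => p x * k x y) != 0].
Proof.
have fU := finite_support2 (coef_finite p) (fun x => coef_finite (k x)).
apply: (sub_finite_set _ fU) => y /= /eqP h; apply: contrapT => hU; apply: h.
rewrite /fsum fsbig1// => x _; have [->|px] := eqVneq (p x) 0.
  by rewrite mul0r.
have [->|kxy] := eqVneq (k x y) 0; first by rewrite mulr0.
by case: hU; exists x.
Qed.

Lemma bind_ge0 (R : realType) (X Y : Type) (p : dist R X)
    (k : X -> dist R Y) (y : Y) : 0 <= fsum (fun x => p x * k x y).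
Proof. by apply: fsum_ge0 => x; rewrite mulr_ge0 ?coef_ge0. Qed.

Lemma bind_sum1 (R : realType) (X Y : Type) (p : dist R X)
    (k : X -> dist R Y) : fsum (fun y => fsum (fun x => p x * k x y)) = 1.
Proof.
transitivity (fsum (fun y => fsum (fun x => p x * k x y) * 1)).
  by apply: eq_fsum => y; rewrite mulr1.
rewrite (fsum_bind (fun=> 1) (coef_finite p)); last first.
  by move=> x; exact: coef_finite.
rewrite -[RHS](coef_sum1 p); apply: eq_fsum => x.
rewrite -[RHS]mulr1; congr (_ * _); rewrite -[RHS](coef_sum1 (k x)).
by apply: eq_fsum => y; rewrite mulr1.
Qed.

(* [sum_i l_i |x_i>  |->  sum_i l_i k(x_i)] *)
Definition dbind (R : realType) (X Y : Type) (p : dist R X)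
    (k : X -> dist R Y) : dist R Y :=
  Dist (bind_finite p k) (bind_ge0 p k) (bind_sum1 p k).

Lemma dbind_unitl (R : realType) (X Y : Type) (a : X) (k : X -> dist R Y) :
  dbind (dunit R a) k = k a.
Proof. by apply: dist_ext => y; exact: (fsum_delta a (fun x => k x y)). Qed.

Lemma dbind_unitr (R : realType) (X : Type) (p : dist R X) :
  dbind p (@dunit R X) = p.
by apply: dist_ext => x; exact: fsum_delta_r. Qed.

Lemma dbind_assoc (R : realType) (X Y Z : Type) (p : dist R X)
    (k : X -> dist R Y) (l : Y -> dist R Z) :
  dbind (dbind p k) l = dbind p (fun x => dbind (k x) l).
Proof.
apply: dist_ext => z /=; apply: fsum_bind; first exact: coef_finite.
by move=> x; exact: coef_finite.
Qed.

Definition dmap (R : realType) (X Y : Type) (f : X -> Y) (p : dist R X) :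
  dist R Y := dbind p (fun x => dunit R (f x)).

Lemma dmap_id (R : realType) (X : Type) (p : dist R X) : dmap id p = p.
Proof. exact: dbind_unitr. Qed.

Lemma dbind_map (R : realType) (X Y Z : Type) (f : X -> Y) (p : dist R X)
    (k : Y -> dist R Z) : dbind (dmap f p) k = dbind p (k \o f).
Proof.
rewrite /dmap dbind_assoc; congr dbind.
by apply: funext => x; rewrite dbind_unitl.
Qed.

Lemma dmap_comp (R : realType) (X Y Z : Type) (g : Y -> Z) (f : X -> Y)
  (p : dist R X) : dmap (g \o f) p = dmap g (dmap f p).
Proof. by rewrite {2}/dmap dbind_map. Qed.

Definition D (R : realType) : functor :=
  @Functor (dist R) (@dmap R) (@dmap_id R) (@dmap_comp R).

(* The coefficient of [x] is [sum_i l_i * m_i(x)]. *)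
Definition dmult (R : realType) (X : Type) (p : dist R (dist R X)) :
  dist R X := dbind p id.

Lemma omap_id' (X : Type) (a : option X) : omap id a = a.
Proof. by case: a. Qed.

Lemma omap_comp' (X Y Z : Type) (g : Y -> Z) (f : X -> Y) (a : option X) :
  omap (g \o f) a = omap g (omap f a).
Proof. by case: a. Qed.

Definition M : functor := @Functor option (@Option.map) omap_id' omap_comp'.

Definition omult (X : Type) (a : option (option X)) : option X := obind id a.

(* An element [p] of [DM R X] is the subdistribution with coefficients
   [x |-> p (Some x)]; the missing mass is [p None]. *)
Definition DM (R : realType) : functor := functor_comp (D R) M.

Definition DMunit (R : realType) (X : Type) (x : X) : DM R X :=
  dunit R (Some x).

Definition DMkl (R : realType) (X Y : Type) (k : X -> DM R Y) (a : option X) :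
  DM R Y := if a is Some x then k x else dunit R None.

Definition DMmult (R : realType) (X : Type) (p : DM R (DM R X)) : DM R X :=
  dbind p (DMkl id).

Lemma fsum_option (R : realType) (X : Type) (F : option X -> R) :
  finite_set [set a | F a != 0] ->
  fsum F = F None + fsum (fun x => F (Some x)).
Proof.
move=> fF.
pose S := [set x : {classic X} | F (Some x) != 0].
have fS : finite_set S.
  rewrite (_ : S = Some @^-1` [set a | F a != 0])//.
  by apply: finite_preimage => // x y _ _ [].
rewrite (@fsumE R X (fset_set S)); last first.
  move=> x; rewrite in_fset_set// => /negP; rewrite inE /S /= => h.
  by apply/eqP/negPn/negP.
pose h (x : {classic X}) : {classic (option X)} := Some x.
rewrite (@fsumE R _ ((None : {classic (option X)}) |` h @` (fset_set S))%fset).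
  rewrite big_fsetU1 /=; last by apply/imfsetP => -[].
  by congr (_ + _); rewrite big_imfset//= => x y _ _ [].
case=> [x|]; last by rewrite !inE eqxx.
rewrite !inE => /norP[_ /imfsetP hx].
apply/eqP/negPn/negP => Fx; apply: hx; exists x => //.
by rewrite in_fset_set// inE.
Qed.

Lemma DM_ext (R : realType) (X : Type) (p q : DM R X) :
  (forall x, p (Some x) = q (Some x)) -> p = q.
Proof.
move=> pq; apply: dist_ext => -[x|]; first exact: pq.
have := coef_sum1 q; rewrite -(coef_sum1 p) !fsum_option; last 2 first.
- exact: coef_finite.
- exact: coef_finite.
by rewrite (eq_fsum pq) => /addIr.
Qed.

Lemma DMmultE (R : realType) (X : Type) (p : DM R (DM R X)) (x : X) :
  DMmult p (Some x) = fsum (fun q : DM R X => p (Some q) * q (Some x)).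
Proof.
rewrite /DMmult /= fsum_option /=; first by rewrite asboolF ?mulr0 ?add0r.
apply: (sub_finite_set _ (coef_finite p)) => a /=.
by apply: contraNneq => ->; rewrite mul0r.
Qed.

Definition DM_data (R : realType) : magmad_data :=
  @MagmadData (DM R) (@DMunit R) (@DMmult R).

Lemma DM_is_magmad (R : realType) : is_magmad (DM_data R).
Proof.
split=> [X Y f x|X Y f p|X p|X p]; rewrite /= /DMmult.
- by rewrite /dmap /DMunit dbind_unitl.
- rewrite dbind_map /dmap dbind_assoc; congr dbind.
  by apply: funext => -[q|] //=; rewrite dbind_unitl.
- by rewrite /DMunit dbind_unitl.
- rewrite dbind_map -[RHS]dbind_unitr; congr dbind.
  by apply: funext => -[].
Qed.

Lemma DM_assoc (R : realType) : mult_associative (DM_data R).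
Proof.
move=> X p; rewrite /= /DMmult dbind_map dbind_assoc; congr dbind.
by apply: funext => -[q|] //=; rewrite dbind_unitl.
Qed.

Definition subdistribution_monad (R : realType) : monad :=
  Monad (@DM_is_magmad R) (@DM_assoc R).

Definition MD (R : realType) : functor := functor_comp M (D R).

Definition mass (R : realType) (X : Type) (p : DM R X) : R :=
  fsum (fun x => p (Some x)).

Lemma normalized_finite (R : realType) (X : Type) (p : DM R X) :
  finite_set [set x | p (Some x) / mass p != 0].
Proof.
apply: (@sub_finite_set _ _ (Some @^-1` [set a | p a != 0])).
  by move=> x /=; apply: contraNneq => ->; rewrite mul0r.
by apply: finite_preimage (coef_finite p) => x y _ _ [].
Qed.

Lemma normalized_ge0 (R : realType) (X : Type) (p : DM R X) (x : X) :
  0 <= p (Some x) / mass p.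
Proof.
by rewrite divr_ge0 ?coef_ge0//; apply: fsum_ge0 => y; exact: coef_ge0.
Qed.

Lemma normalized_sum1 (R : realType) (X : Type) (p : DM R X) :
  mass p != 0 -> fsum (fun x => p (Some x) / mass p) = 1.
Proof.
by move=> p0; rewrite /fsum -mulr_fsuml -/(fsum _) -/(mass p) divff.
Qed.

Definition normalized (R : realType) (X : Type) (p : DM R X)
    (p0 : mass p != 0) : dist R X :=
  Dist (normalized_finite p) (normalized_ge0 p) (normalized_sum1 p0).

Definition normalize (R : realType) (X : Type) (p : DM R X) : MD R X :=
  if eqVneq (mass p) 0 is NeqNotEq p0 then Some (normalized p0) else None.

Definition MDunit (R : realType) (X : Type) (x : X) : MD R X :=
  Some (dunit R x).

Definition MDmult (R : realType) (X : Type) (a : MD R (MD R X)) : MD R X :=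
  fmap M (@dmult R X) (omult (fmap M (@normalize R (D R X)) a)).

Definition MD_data (R : realType) : magmad_data :=
  @MagmadData (MD R) (@MDunit R) (@MDmult R).

(* Main.v *)
Require Import Defs.
From mathcomp Require Import all_boot all_order all_algebra finmap.
From mathcomp Require Import boolp classical_sets cardinality.
From mathcomp Require Import fsbigop reals.

(** The action is [u = mu^M . M(normalize) . M(mu^D)]: flatten the two layers
    of probability, then normalize the resulting subdistribution.

    Normalization forgets exactly the scale of a subdistribution: its value is
    [Some d] when the subdistribution is a nonzero multiple of the distribution
    [d], and [None] when it is zero.  Since Kleisli extension of
    subdistributions is linear, it commutes with rescaling its argument, so
    normalizing the argument beforehand does not change the normalized result;
    this is [normalize_bind].  Together with the fact that a distribution is
    its own normalization ([normalize_total]), it gives everything: naturality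
    of normalization is the case of the Kleisli map [DMunit \o f], and
    compatibility of [u] with the multiplication of subdistributions is the
    case of the identity.

    Only the outer layer of probability may be rescaled in this way.  On the
    side [MDmult \o MD MDmult] of the associativity law the inner layers are
    normalized too, by factors that vary with the outcome; this changes their
    relative weights, hence only a magmad. *)

Set Implicit Arguments.
Unset Strict Implicit.
Unset Printing Implicit Defensive.

Import Order.TTheory GRing.Theory Num.Theory.
Local Open Scope classical_set_scope.
Local Open Scope ring_scope.

Lemma fsum_eq0 (R : realType) (X : Type) (F : X -> R) :
  finite_set [set x | F x != 0] -> (forall x, 0 <= F x) -> fsum F = 0 ->
  forall x, F x = 0.
Proof.
move=> fF F0.
pose A := fset_set ([set x | F x != 0] : set {classic X}).
have FA (x : {classic X}) : x \notin A -> F x = 0.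
  by rewrite in_fset_set// => /negP; rewrite inE /= => /negP/negPn/eqP.
rewrite (fsumE FA) => /eqP; rewrite psumr_eq0 => [/allP A0 x|//].
have [/A0/eqP//|/FA//] := boolP ((x : {classic X}) \in A).
Qed.

Lemma fsumZ (R : realType) (X : Type) (c : R) (F : X -> R) :
  fsum (fun x => c * F x) = c * fsum F.
Proof. by rewrite /fsum mulr_fsumr. Qed.

Lemma coef_Some_finite (R : realType) (X : Type) (p : DM R X) :
  finite_set [set x | p (Some x) != 0].
Proof. by apply: finite_preimage (coef_finite p) => x y _ _ []. Qed.

Section Normalization.
Variable R : realType.
Implicit Types X Y : Type.

(** Subdistributions up to scale: the two cases determine the value of
    [normalize], see [normalize_none] and [normalize_some]. *)
Variant normalize_spec X (p : DM R X) : MD R X -> Prop :=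
| NormalizeZero of (forall x, p (Some x) = 0) : normalize_spec p None
| NormalizeScaled c (d : dist R X) of c != 0
    & (forall x, p (Some x) = c * d x) : normalize_spec p (Some d).

Lemma normalizeP X (p : DM R X) : normalize_spec p (normalize p).
Proof.
rewrite /normalize; case: eqVneq => [p0|p0].
  apply: NormalizeZero; apply: fsum_eq0 p0; first exact: coef_Some_finite.
  by move=> x; exact: coef_ge0.
by apply: (NormalizeScaled p0) => x /=; rewrite mulrC divfK.
Qed.

Lemma normalize_none X (p : DM R X) :
  (forall x, p (Some x) = 0) -> normalize p = None.
Proof.
move=> p0; case: normalizeP => // c d c0 pd.
have d0 x : d x = 0 by apply: (mulfI c0); rewrite -pd p0 mulr0.
have := coef_sum1 d; rewrite (eq_fsum d0) /fsum fsbig1// => /eqP.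
by rewrite eq_sym oner_eq0.
Qed.

Lemma normalize_some X (p : DM R X) c (d : dist R X) :
  c != 0 -> (forall x, p (Some x) = c * d x) -> normalize p = Some d.
Proof.
move=> c0 pd.
have pc : mass p = c by rewrite /mass (eq_fsum pd) fsumZ coef_sum1 mulr1.
rewrite /normalize; case: eqVneq => [p0|p0].
  by move: c0; rewrite -pc p0 eqxx.
by congr Some; apply: dist_ext => x /=; rewrite pd pc mulrC mulKf.
Qed.

Lemma normalize_scale X (p q : DM R X) c :
  c != 0 -> (forall x, p (Some x) = c * q (Some x)) ->
  normalize p = normalize q.
Proof.
move=> c0 pq; case: (normalizeP q) => [q0|b d b0 qd].
  by apply: normalize_none => x; rewrite pq q0 mulr0.
apply: (@normalize_some _ _ (c * b)); first by rewrite mulf_neq0.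
by move=> x; rewrite pq qd mulrA.
Qed.

Lemma normalize_total X (d : dist R X) : normalize (dmap Some d) = Some d.
Proof.
apply: (@normalize_some _ _ 1); rewrite ?oner_eq0// => x /=.
rewrite mul1r -[RHS]fsum_delta_r; apply: eq_fsum => y.
by congr (_ * _%:R); congr nat_of_bool; apply: asbool_equiv_eq; split=> [[]|->].
Qed.

Lemma DMbindE X Y (p : DM R X) (k : X -> DM R Y) (y : Y) :
  dbind p (DMkl k) (Some y) = fsum (fun x => p (Some x) * k x (Some y)).
Proof.
rewrite /= fsum_option /=; first by rewrite asboolF ?mulr0 ?add0r.
apply: sub_finite_set (coef_finite p) => a /=.
by apply: contraNneq => ->; rewrite mul0r.
Qed.

(** Kleisli extension is linear in the subdistribution [p], so rescaling [p]
    to total mass one rescales the result by the same factor. *)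
Lemma normalize_bind X Y (p : DM R X) (k : X -> DM R Y) :
  normalize (dbind p (DMkl k)) =
  obind (fun d : dist R X => normalize (dbind d k)) (normalize p).
Proof.
case: (normalizeP p) => [p0|c d c0 pd] /=.
  apply: normalize_none => y; rewrite DMbindE /fsum fsbig1// => x _.
  by rewrite p0 mul0r.
apply: (normalize_scale c0) => y; rewrite DMbindE /= -fsumZ.
by apply: eq_fsum => x; rewrite pd mulrA.
Qed.

Lemma normalize_map X Y (f : X -> Y) (p : DM R X) :
  normalize (fmap (DM R) f p) = fmap (MD R) f (normalize p).
Proof.
have -> : fmap (DM R) f p = dbind p (DMkl (@DMunit R Y \o f)).
  by rewrite /= /dmap; congr dbind; apply: funext => -[].
rewrite normalize_bind; case: (normalize p) => //= d.
by rewrite -normalize_total /dmap -dbind_map.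
Qed.

Lemma dmult_map X Y (f : X -> Y) (p : dist R (dist R X)) :
  dmult (dmap (dmap f) p) = dmap f (dmult p).
Proof. by rewrite /dmult dbind_map /dmap dbind_assoc. Qed.

Lemma MDmult_Some X (p : dist R (MD R X)) :
  MDmult (Some p) = omap (@dmult R X) (normalize (X := D R X) p).
Proof. by []. Qed.

Lemma MD_is_magmad : is_magmad (MD_data R).
Proof.
split=> [X Y f x|X Y f [p|//]|X [d|]|X [d|//]].
- by rewrite /= /MDunit /dmap dbind_unitl.
- rewrite [LHS]MDmult_Some [mult_of _ _]MDmult_Some.
  rewrite [normalize _](normalize_map (fmap (D R) f)).
  by case: (normalize _) => //= q; rewrite dmult_map.
- have dE : dunit R (Some d) = dmap Some (dunit R d).
    by rewrite /dmap dbind_unitl.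
  by rewrite [LHS]MDmult_Some dE normalize_total /= /dmult dbind_unitl.
- rewrite [LHS]MDmult_Some normalize_none// => x /=.
  by rewrite asboolF.
- rewrite [LHS]MDmult_Some [fmap _ _ _](dmap_comp Some (@dunit R X)).
  rewrite normalize_total /=.
  by rewrite /dmult dbind_map dbind_unitr.
Qed.

Definition MDaction X (a : MD R (DM R X)) : MD R X :=
  obind (fun p : dist R (DM R X) => normalize (dmult p)) a.

Lemma MDaction_is_right_action :
  is_right_action (T := subdistribution_monad R) (N := MD_data R) MDaction.
Proof.
split=> [X Y f [p|//]|X [p|//]|X [p|//]] /=.
- by rewrite dmult_map [LHS](normalize_map f).
- by rewrite /dmult dbind_map normalize_total.
- (* Associativity of [dbind] turns the left side into the multiplication
     of the flattened [p]. *)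
  rewrite /dmult dbind_map /comp.
  have -> : dbind p (fun x => id (DMmult x)) = DMmult (dmult p).
    by rewrite /DMmult /dmult dbind_assoc.
  exact: normalize_bind.
Qed.

End Normalization.

Theorem corollary4p4 (R : realType) :
  is_magmad (MD_data R) /\
  exists u : forall X : Type, MD_data R (subdistribution_monad R X) -> MD_data R X,
    is_right_action (T := subdistribution_monad R) (N := MD_data R) u.
Proof.
split; first exact: MD_is_magmad.
by exists (@MDaction R); exact: MDaction_is_right_action.
Qed.
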